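(* Let $\mathrm{PoF}_n$ denote the price of MMS with respect to utilitarian welfare for allocating contiguous blocks of goods to $n$ agents. Then $\mathrm{PoF}_n=\Omega(\sqrt n)$ and $\mathrm{PoF}_n=O(n)$; that is, there are absolute constants $c,C>0$ such that $c\sqrt n\le \mathrm{PoF}_n\le C n$ for every integer $n\ge 3$.
   Context: A fair-goods instance $\mathcal I=\langle N,E,\mathcal V\rangle$ consists of agents $N=\{1,\dots,n\}$, indivisible items $E=\{e_1,\dots,e_m\}$ placed on a path in this order, and for each agent $i$ an additive valuation $v_i$ (i.e. $v_i(S)=\sum_{e\in S}v_i(e)$) with $v_i(e)\ge 0$ for all $e\in E$, normalized so that $v_i(\emptyset)=0$, $v_i(E)=1$. A bundle is connected if it is a set of consecutive items (the empty set is allowed). An allocation $\mathbf A=(A_1,\dots,A_n)$ is a partition of $E$ into $n$ pairwise disjoint connected (possibly empty) bundles, $A_i$ being given to agent $i$ (the left-to-right order of the agents' bundles is arbitrary). Its utilitarian welfare is $\mathsf{UW}(\mathbf A)=\sum_{i\in N}v_i(A_i)$; $\mathsf{OPT}_U(\mathcal I)$ is the maximum of $\mathsf{UW}$ over all allocations of $\mathcal I$. The maximin share of agent $i$ is $\mathsf{MMS}_i(\mathcal I)=\max_{\mathbf X}\min_{j\in[n]}v_i(X_j)$, the maximum over all partitions $\mathbf X=(X_1,\dots,X_n)$ of $E$ into $n$ connected (possibly empty) bundles. An allocation $\mathbf A$ is MMS fair if $v_i(A_i)\ge \mathsf{MMS}_i(\mathcal I)$ for all $i\in N$. The price of fairness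 is $\mathrm{PoF}_n=\sup_{\mathcal I}\min_{\mathbf A}\frac{\mathsf{OPT}_U(\mathcal I)}{\mathsf{UW}(\mathbf A)}$, the supremum over all fair-goods instances with $n$ agents (any number of items) and the minimum over all MMS fair allocations $\mathbf A$ of $\mathcal I$; conventions: $c/0=+\infty$ for $c>0$ and $0/0=1$. *)

(* Defs.v *)
From HB Require Import structures.
From mathcomp Require Import all_boot all_order all_algebra.
From mathcomp Require Import classical_sets reals constructive_ereal ereal.

Set Implicit Arguments.
Unset Strict Implicit.
Unset Printing Implicit Defensive.

Import Order.TTheory GRing.Theory Num.Theory.
Local Open Scope ring_scope.

(* Items are the elements of 'I_m, lying on the path in their natural order;
   value i e is the value of the single item e for agent i. *)
Record instance (R : realType) (n : nat) := Instance {
  items : nat;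
  value : 'I_n -> 'I_items -> R;
  value_ge0 : forall i e, 0 <= value i e;
  value_sum1 : forall i, \sum_(e < items) value i e = 1
}.

Definition connected_bundle (m : nat) (S : {set 'I_m}) : bool :=
  [forall a in S, forall c in S, forall b : 'I_m,
     (a <= b <= c)%N ==> (b \in S)].

(* The bundles are indexed by the agents, in no prescribed left-to-right
   order, and may be empty. *)
Definition connected_partition (n m : nat) (A : {ffun 'I_n -> {set 'I_m}}) :
    bool :=
  [&& [forall i, connected_bundle (A i)],
      [forall i, forall j, (i != j) ==> [disjoint A i & A j]]
    & (\bigcup_i A i == [set: 'I_m])%SET].

Section Instance.
Variables (R : realType) (n : nat) (I : instance R n).

Definition allocation := {ffun 'I_n -> {set 'I_(items I)}}.

Definition bundle_value (i : 'I_n) (S : {set 'I_(items I)}) : R :=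
  \sum_(e in S) value i e.

Definition UW (A : allocation) : R := \sum_i bundle_value i (A i).

(* Welfare is nonnegative, so the default 0 does not affect the maximum. *)
Definition OPT_U : R :=
  \big[Num.max/0]_(A : allocation | connected_partition A) UW A.

(* No bundle is worth more to i than the set of all items, nor less than 0,
   so neither default affects the extrema (for n > 0). *)
Definition MMS (i : 'I_n) : R :=
  \big[Num.max/0]_(X : allocation | connected_partition X)
    \big[Num.min/bundle_value i [set: 'I_(items I)]%SET]_(j < n)
      bundle_value i (X j).

Definition MMS_fair (A : allocation) : bool :=
  connected_partition A && [forall i, MMS i <= bundle_value i (A i)].

End Instance.

(* x / y for x, y >= 0, with c / 0 = +oo for c > 0 and 0 / 0 = 1. *)
Definition welfare_ratio (R : realType) (x y : R) : \bar R :=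
  if y == 0 then (if x == 0 then 1%E else +oo%E) else (x / y)%:E.

(* The minimum over an empty family is +oo. *)
Definition price (R : realType) (n : nat) (I : instance R n) : \bar R :=
  \big[Order.min/+oo%E]_(A : allocation I | MMS_fair A)
    welfare_ratio (OPT_U I) (UW A).

Definition PoF (R : realType) (n : nat) : \bar R :=
  ereal_sup (range (@price R n)).

(* Main.v *)
Require Import Defs.
From mathcomp Require Import all_boot all_order all_algebra.
From mathcomp Require Import classical_sets reals constructive_ereal ereal.
From mathcomp Require Import zify ring lra.
Local Open Scope ring_scope.
Import Order.TTheory GRing.Theory Num.Theory.

(** Upper bound.  A left-to-right moving knife yields an MMS fair allocation even
    when some agents i are promised an item e with v_i(e) >= MMS_i in advance:
    the knife stops as soon as an agent with no promise reaches her share, or at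
    a promised item, and a single stop destroys at most one part of any other
    agent's maximin partition.  Hence the welfare of some fair allocation is at
    least both the sum of the MMS_i and the weight of any matching of agents
    with items they value at least MMS_i.  An agent with MMS_i much smaller than
    1/n has almost all her value on fewer than n items, and matching a row of at
    most n entries from each of n agents recovers a 1/(2n) fraction of the total.
    So some fair allocation has welfare at least 3/16, while the optimum is at
    most n.

    Lower bound.  Take n items, all of positive value to everyone, so that a
    fair allocation gives exactly one item to each agent.  With k about sqrt n,
    let k agents have half of their value spread over pairwise disjoint blocks
    of k items: the optimum is at least k/2, but fair welfare is at most 2. *)

(** * Cutting a path into valuable intervals, and the moving knife *)

Section Splits.
Variable R : realDomainType.
Implicit Types (w : nat -> R) (t : R).

Lemma ler_sum_nat_sub w (w0 : forall x, 0 <= w x) {p p' q q' : nat} :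
  (p' <= p)%N -> (q <= q')%N ->
  \sum_(p <= x < q) w x <= \sum_(p' <= x < q') w x.
Proof.
move=> pp qq; have [pq|qp] := leqP p q; last first.
  by rewrite big_geq ?sumr_ge0 // ltnW.
rewrite (big_cat_nat pp (leq_trans pq qq)) /= (big_cat_nat pq qq) /=.
rewrite addrCA lerDl addr_ge0 // sumr_ge0 //.
Qed.

Lemma ler_sum_nat_term w (w0 : forall x, 0 <= w x) {p q e : nat} :
  (p <= e < q)%N -> w e <= \sum_(p <= x < q) w x.
Proof.
by case/andP=> pe eq; have := ler_sum_nat_sub w w0 pe eq; rewrite big_nat1.
Qed.

(* The items after the last cut point are left over. *)
Fixpoint splits w t (m k p : nat) : Prop :=
  if k is k'.+1 then
    exists q : nat, [/\ (p <= q)%N, (q <= m)%N, t <= \sum_(p <= x < q) w x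
                      & splits w t m k' q]
  else True.

Lemma splits_le w t m k p p' (w0 : forall x, 0 <= w x) :
  (p' <= p)%N -> splits w t m k p -> splits w t m k p'.
Proof.
case: k => [//|k] pp [q [pq qm tq sq]]; exists q; split => //.
  exact: leq_trans pq.
exact: le_trans tq (ler_sum_nat_sub w w0 pp (leqnn q)).
Qed.

(** Cut greedily, each time as early as possible. Every piece but its last item is worth less than
    [t], so a piece holds at most one item of value at least [t], and its smaller items total at
    most [2t]. Fewer than [k] greedy cuts succeed, and the remainder after them is worth less than
    [t]. *)
Lemma not_splits w t m k p (w0 : forall x, 0 <= w x) : 0 < t -> (p <= m)%N ->
  ~ splits w t m k p ->
  (\sum_(p <= x < m) (t <= w x)%R < k)%N /\
  \sum_(p <= x < m | w x < t) w x <= t *+ (2 * k).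
Proof.
move=> t0; elim: k p => [p _ []//|k IH p pm nS].
have [small|large] := ltP (\sum_(p <= x < m) w x) t.
  have wt x : (p <= x < m)%N -> w x < t.
    by move=> xm; apply: le_lt_trans small; apply: ler_sum_nat_term.
  split.
    rewrite big_nat big1 // => x xm.
    by rewrite leNgt wt.
  rewrite big_nat_cond (eq_bigl (fun x => (p <= x < m)%N && true)); last first.
    by move=> x; rewrite andbT; apply: andb_idr => /wt.
  rewrite -big_nat_cond (le_trans (ltW small)) // -[leLHS]mulr1n.
  by apply: ler_wpMn2l; [exact: ltW|lia].
have exq : exists q, (p <= q)%N && (t <= \sum_(p <= x < q) w x) by exists m; rewrite pm.
case: (ex_minnP exq) => q /andP[pq tq] qmin.
have qm : (q <= m)%N by apply: qmin; rewrite pm.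
have pltq : (p < q)%N.
  rewrite ltn_neqAle pq andbT; apply/eqP => pqE.
  by move: tq; rewrite -pqE big_geq // leNgt t0.
have [|cnt smq] := IH q qm.
  by move=> Sq; apply: nS; exists q.
case: q pq tq qmin qm pltq cnt smq => // q _ tq qmin qm pq cnt smq.
(* After the renaming the greedy cut is [q.+1], and [q] is the last item of the piece; minimality
   bounds the piece without it. *)
have before : \sum_(p <= x < q) w x < t.
  rewrite ltNge; apply/negP => tq'.
  by have := qmin q; rewrite tq' -ltnS pq ltnn => /(_ isT).
have wt x : (p <= x < q)%N -> w x < t.
  by move=> xm; apply: le_lt_trans before; apply: ler_sum_nat_term.
rewrite ltnS in pq.
rewrite !(big_cat_nat (leqW pq) qm) /=; split.
  rewrite big_nat_recr //= big_nat big1 ?add0n; last by move=> x /wt; rewrite leNgt => ->.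
  by move: cnt; case: (t <= w q); lia.
rewrite mulnS mulrnDr lerD //.
rewrite mulr2n big_mkcond big_nat_recr //= lerD //; last by case: ltP => [/ltW|_] //; exact: ltW.
apply: le_trans (ltW before); apply: ler_sum => x _.
by case: ifP.
Qed.

(* The first cut is made at the earliest right end of a bundle. *)
Lemma splits_family (I : eqType) (X : I -> pred nat) w t m (s : seq I) p
    (w0 : forall x, 0 <= w x) :
  (p <= m)%N -> uniq s ->
  (forall i x, i \in s -> X i x -> (p <= x < m)%N) ->
  (forall i x y z, i \in s -> X i x -> X i z -> (x <= y <= z)%N -> X i y) ->
  (forall i j x, i \in s -> j \in s -> X i x -> X j x -> i = j) ->
  (forall i, i \in s -> t <= \sum_(p <= x < m | X i x) w x) ->
  splits w t m (size s) p.
Proof.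
move: {-2}(size s) (erefl (size s)) => k.
elim: k s p => [//|k IH] s p sk pm us Xsub Xconn Xdisj Xval.
(* Bundle [i] lies left of [q]; ranging over [iota 0 m] keeps this boolean, as the search for a
   least [q] requires. *)
pose fin i q := [&& (p <= q)%N & all (fun x => X i x ==> (x < q)%N) (iota 0 m)].
have finP i q : i \in s -> reflect ((p <= q)%N /\ forall x, X i x -> (x < q)%N) (fin i q).
  move=> si; apply: (iffP andP) => -[pq H]; split=> //.
    move=> x Xx; have /allP/(_ x) := H.
    rewrite mem_iota /= add0n; have /andP[_ ->] := Xsub i x si Xx.
    by rewrite Xx /=; apply.
  by apply/allP => x _; apply/implyP/H.
have exq : exists q, has (fun i => fin i q) s.
  case: s sk us {IH Xconn Xdisj Xval} Xsub finP => // i s _ _ Xsub finP.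
  exists m; apply/hasP; exists i; first exact: mem_head.
  apply/finP; first exact: mem_head.
  by split=> // x /Xsub; rewrite mem_head => /(_ isT)/andP[].
case: (ex_minnP exq) => q /hasP[i si /(finP _ _ si)[pq Xq]] qmin.
have qm : (q <= m)%N.
  apply: qmin; apply/hasP; exists i => //; apply/finP => //; split=> // x Xx.
  by have /andP[] := Xsub i x si Xx.
exists q; split=> //.
  apply: le_trans (Xval i si) _.
  rewrite (big_cat_nat pq qm) /= [X in _ + X]big_nat_cond [X in _ + X]big_pred0 ?addr0; last first.
    by move=> x; apply/negP => /andP[/andP[qx _] /Xq]; rewrite ltnNge qx.
  by rewrite big_mkcond ler_sum // => x _; case: ifP.
have ks : k = size (rem i s) by rewrite size_rem // -sk.
have sub j : j \in rem i s -> j \in s by move/mem_rem.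
(* Suppose [X j] had an item left of [q]. Minimality puts item [q - 1] in [X i], hence outside
   [X j], and connectedness then keeps [X j] strictly left of [q - 1], so that [X j] would end
   before [q]. *)
have above j x : j \in rem i s -> X j x -> (q <= x)%N.
  move=> rj Xx; have sj := sub _ rj; rewrite leqNgt; apply/negP => xq.
  have ji : j != i by move: rj; rewrite mem_rem_uniq // inE => /andP[].
  have px : (p <= x)%N by have /andP[] := Xsub j x sj Xx.
  case: q qmin Xq xq {pq qm} => // q qmin Xq xq.
  have Xiq : X i q.
    apply/negPn/negP => nX.
    have /qmin : has (fun i => fin i q) s; last by rewrite ltnn.
    apply/hasP; exists i => //; apply/finP => //; split; first exact: leq_trans px _.
    move=> y Xy; have := Xq y Xy; rewrite ltnS leq_eqVlt => /predU1P[yq|//].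
    by move: nX; rewrite -yq Xy.
  have nXj : ~~ X j q by apply: contra ji => Xjq; apply/eqP/(Xdisj _ _ q).
  have /qmin : has (fun i => fin i q) s; last by rewrite ltnn.
  apply/hasP; exists j => //; apply/finP => //; split; first exact: leq_trans px _.
  move=> y Xy; rewrite ltnNge; apply/negP => qy; case/negP: nXj.
  by apply: (Xconn j x q y) => //; rewrite -ltnS xq qy.
rewrite ks in IH *.
apply: IH => //.
- exact: rem_uniq.
- move=> j x rj Xx; rewrite (above j) //=.
  by have /andP[] := Xsub j x (sub _ rj) Xx.
- by move=> j x y z /sub; apply: Xconn.
- by move=> j l x /sub sj /sub sl; apply: Xdisj.
- move=> j rj; apply: le_trans (Xval j (sub _ rj)) _.
  rewrite (big_cat_nat pq qm) /= [X in X + _]big_nat_cond [X in X + _]big_pred0 ?add0r //.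
  by move=> x; apply/negP => /andP[/andP[_ xq] /(above _ _ rj)]; rewrite leqNgt xq.
Qed.

(** Induction on the agents still present. At the least [q] where someone is served, that agent
    leaves with the items from [p] to [q - 1]. Any other agent without a promise has her first cut
    at or after [q], since otherwise she would have been served earlier; her later cuts therefore
    split what remains. The last agent takes all that is left. The map [h] sends an item to its
    owner. *)
Lemma moving_knife (T : eqType) (w : T -> nat -> R) (mu : T -> R)
    (f : T -> option nat) (m : nat) (s : seq T) (p : nat) :
  (forall i x, 0 <= w i x) ->
  (forall i j e, f i = Some e -> f j = Some e -> i = j) ->
  s != [::] -> uniq s ->
  (forall i e, i \in s -> f i = Some e -> (p <= e < m)%N /\ mu i <= w i e) ->
  (forall i, i \in s -> f i = None -> splits (w i) (mu i) m (size s) p) ->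
  exists h : nat -> T,
    [/\ forall x, (p <= x < m)%N -> h x \in s,
        forall x y z, (p <= x)%N -> (x <= y <= z)%N -> (z < m)%N ->
          h x = h z -> h y = h x,
        forall i, i \in s -> mu i <= \sum_(p <= x < m | h x == i) w i x
      & forall i e, i \in s -> f i = Some e -> h e = i].
Proof.
move=> w0 finj; move: {-2}(size s) (erefl (size s)) => k.
elim: k s p => [|k IH] s p; first by move/esym/size0nil->.
move=> sk _ us fs Ds.
case: k IH sk Ds => [|k] IH sk Ds.
  case: s sk us fs Ds {IH} => // i [] // _ _ fs Ds.
  exists (fun=> i); split=> //.
  - by move=> x _; exact: mem_head.
  - move=> j; rewrite inE => /eqP->.
    rewrite (eq_bigl xpredT) => [|x]; last exact: eqxx.
    case fi : (f i) => [e|].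
      have [em mue] := fs i e (mem_head _ _) fi.
      exact: le_trans mue (ler_sum_nat_term _ (w0 i) em).
    have [q [_ qm tq _]] := Ds i (mem_head _ _) fi.
    exact: le_trans tq (ler_sum_nat_sub _ (w0 i) (leqnn p) qm).
  - by move=> j e; rewrite inE => /eqP->.
(* An agent with a promise waits for the promised item, even when earlier items are already worth
   enough. *)
pose served q i := if f i is Some e then (e < q)%N
                   else mu i <= \sum_(p <= x < q) w i x.
have exq : exists q, (p <= q <= m)%N && has (served q) s.
  case: s sk us fs Ds => // i s _ _ fs Ds.
  case fi : (f i) => [e|].
    have [/andP[pe em] _] := fs i e (mem_head _ _) fi.
    by exists e.+1; rewrite (leqW pe) em /= /served fi leqnn.
  have [q [pq qm tq _]] := Ds i (mem_head _ _) fi.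
  by exists q; rewrite pq qm /= /served fi tq.
case: (ex_minnP exq) => q /andP[/andP[pq qm] hasq] qmin.
have unserved q' i : (p <= q' < q)%N -> i \in s -> ~~ served q' i.
  move=> /andP[pq' q'q] si; apply/negP => Si.
  have hasq' : has (served q') s by apply/hasP; exists i.
  have := qmin q'; rewrite pq' hasq' (leq_trans (ltnW q'q) qm) => /(_ isT).
  by rewrite leqNgt q'q.
(* When the knife stops at a reserved item, its owner has priority. *)
have [i [si Si prio]] : exists i, [/\ i \in s, served q i &
    forall j e, j \in s -> f j = Some e -> (e < q)%N -> i = j].
  have [/hasP[i si]|/hasPn none] := boolP (has (fun i => if f i is Some e then (e < q)%N else false) s).
    case fi : (f i) => [e|//] eq; exists i; split=> //; first by rewrite /served fi.
    (* By minimality of [q], a promised item left of [q] can only be item [q - 1], so it has a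
       single owner. *)
    have last_e j e' : j \in s -> f j = Some e' -> (e' < q)%N -> e'.+1 = q.
      move=> sj fj e'q; apply/eqP; rewrite eqn_leq e'q leqNgt; apply/negP => lt.
      have [/andP[pe' _] _] := fs j e' sj fj.
      have := unserved e'.+1 j; rewrite lt (leqW pe') => /(_ isT sj).
      by rewrite /served fj leqnn.
    move=> j e' sj fj e'q; apply: (finj _ _ e) => //.
    have := last_e _ _ si fi eq; rewrite -(last_e _ _ sj fj e'q) => -[->].
    by [].
  case/hasP: hasq => i si Si; exists i; split=> // j e sj fj eq.
  by have := none j sj; rewrite fj eq.
have sub j : j \in rem i s -> j \in s by move/mem_rem.
have neq j : j \in rem i s -> j != i by rewrite mem_rem_uniq // inE => /andP[].
have [] := IH (rem i s) q.
- by rewrite size_rem // -sk.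
- by rewrite -size_eq0 size_rem // -sk.
- exact: rem_uniq.
- move=> j e rj fj; have [/andP[pe em] mue] := fs j e (sub _ rj) fj.
  split=> //; rewrite em andbT leqNgt; apply/negP => eq.
  by have := neq _ rj; rewrite (prio _ _ (sub _ rj) fj eq) eqxx.
- move=> j rj fj; have [q1 [pq1 q1m tq1 Dq1]] := Ds j (sub _ rj) fj.
  apply: (splits_le _ _ _ _ q1 _ (w0 j)); last exact: Dq1.
  rewrite leqNgt; apply/negP => q1q.
  have := unserved q1 j; rewrite pq1 q1q => /(_ isT (sub _ rj)).
  by rewrite /served fj tq1.
move=> h [hs hconn hval hf].
exists (fun x => if (x < q)%N then i else h x); split.
- move=> x /andP[px xm]; case: ltnP => // qx.
  by apply: sub; apply: hs; rewrite qx.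
- move=> x y z px /andP[xy yz] zm.
  case: (ltnP x q) => xq.
    case: (ltnP z q) => zq; first by rewrite (leq_ltn_trans yz zq).
    by move=> iE; have := neq (h z) (hs z _); rewrite zq zm -iE eqxx => /(_ isT).
  rewrite !ltnNge (leq_trans xq xy) (leq_trans (leq_trans xq xy) yz) /=.
  by apply: hconn; rewrite ?xy.
- move=> j sj; rewrite (big_cat_nat pq qm) /=.
  have [->|ji] := eqVneq j i.
    rewrite -[leLHS]addr0 lerD ?sumr_ge0 //.
    rewrite (big_nat_cond _ _ _ _ _) (eq_bigl (fun x => (p <= x < q)%N && true)); last first.
      by move=> x; case: (ltnP x q) => xq; rewrite ?eqxx // !andbF.
    rewrite -big_nat_cond; move: Si; rewrite /served; case fi : (f i) => [e|//] eq.
    have [/andP[pe em] mue] := fs i e si fi.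
    by apply: le_trans mue _; apply: ler_sum_nat_term; rewrite ?pe.
  have rj : j \in rem i s by rewrite mem_rem_uniq // inE ji.
  rewrite -[leLHS]add0r lerD ?sumr_ge0 //; apply: le_trans (hval j rj) _.
  rewrite [leLHS]big_nat_cond [leRHS]big_nat_cond le_eqVlt; apply/orP; left; apply/eqP.
  by apply: eq_bigl => x; case: (leqP q x).
- move=> j e sj fj; case: ltnP => eq; first exact: prio sj fj eq.
  have [ji|ji] := eqVneq j i; last by apply: hf; rewrite // mem_rem_uniq // inE ji.
  by move: Si; rewrite /served -ji fj ltnNge eq.
Qed.

End Splits.

(** * Matchings that recover a fraction of the total weight *)

Lemma large_matching (R : realDomainType) (I J : finType) (v : I -> J -> R)
    (S : I -> {set J}) :
  (forall i e, 0 <= v i e) -> (forall i, (#|S i| <= #|I|)%N) ->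
  exists f : I -> option J,
    [/\ forall i e, f i = Some e -> e \in S i,
        forall i j e, f i = Some e -> f j = Some e -> i = j
      & \sum_i \sum_(e in S i) v i e
          <= (\sum_i oapp (v i) 0 (f i)) *+ (2 * #|I|)].
Proof.
move=> v0 cS.
pose ok (f : {ffun I -> option J}) :=
  [forall i, forall e, (f i == Some e) ==>
     (e \in S i) && [forall j, (f j == Some e) ==> (j == i)]].
pose W (f : {ffun I -> option J}) := \sum_i oapp (v i) 0 (f i).
have okP (f : {ffun I -> option J}) : reflect ((forall i e, f i = Some e -> e \in S i) /\
    (forall i j e, f i = Some e -> f j = Some e -> i = j)) (ok f).
  apply: (iffP forallP) => [H|[H1 H2] i].
    split=> [i e fi|i j e fi fj].
      by have /forallP/(_ e) := H i; rewrite fi eqxx => /andP[].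
    have /forallP/(_ e) := H j; rewrite fj eqxx => /andP[_ /forallP/(_ i)].
    by rewrite fi eqxx => /eqP.
  apply/forallP => e; apply/implyP => /eqP fi; rewrite (H1 _ _ fi) /=.
  by apply/forallP => j; apply/implyP => /eqP fj; apply/eqP/(H2 _ _ e).
have ok0 : ok [ffun=> None].
  by apply/okP; split=> [i e|i j e]; rewrite ffunE.
case: (Order.TotalTheory.arg_maxP W ok0) => f /okP[fS finj] fmax.
exists f; split=> //.
(* Otherwise reassigning [e] to [i] would increase the weight of [f]. *)
have exch i e : e \in S i ->
    v i e <= oapp (v i) 0 (f i) + \sum_(j | f j == Some e) v j e.
  move=> eS.
  pose g := [ffun j => if j == i then Some e else
                       if f j == Some e then None else f j].
  have /fmax : ok g.
    apply/okP; split=> [j e'|j l e']; rewrite !ffunE.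
      by case: eqP => [-> [<-]//|_]; case: eqP => // _; apply: fS.
    case: (eqVneq j i) => [-> [<-]|_].
      by case: (eqVneq l i) => // _; case: (eqVneq (f l) (Some e)) => // /eqP.
    case: (eqVneq (f j) (Some e)) => // fj fje.
    case: (eqVneq l i) => [_ [ee]|_]; first by rewrite fje ee eqxx in fj.
    by case: (eqVneq (f l) (Some e)) => // _; apply: finj.
  rewrite /= /W [leLHS](bigD1 i) //= [leRHS](bigD1 i) //= ffunE eqxx /=.
  rewrite [X in _ <= _ + X](bigID (fun j => f j == Some e)) /=.
  rewrite [X in _ + X <= _](bigID (fun j => f j == Some e)) /=.
  rewrite [X in _ + (X + _)]big1 ?add0r; last first.
    by move=> j /andP[/negPf ji fj]; rewrite ffunE ji fj.
  rewrite [X in _ + X <= _](eq_bigr (fun j => oapp (v j) 0 (f j))); last first.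
    by move=> j /andP[/negPf ji /negPf fj]; rewrite ffunE ji fj.
  rewrite addrA lerD2r => /le_trans; apply; rewrite lerD2l.
  rewrite [leLHS](eq_bigr (fun j => v j e)); last by move=> j /andP[_ /eqP->].
  rewrite [leLHS]big_mkcond [leRHS]big_mkcond ler_sum // => j _.
  by case: eqP; case: eqP.
have match_sum : \sum_e \sum_(j | f j == Some e) v j e = W f.
  rewrite (exchange_big_dep xpredT) //=; apply: eq_bigr => j _.
  case fj : (f j) => [e|] /=; last by rewrite big_pred0.
  by rewrite (big_pred1 e).
have Wge0 i : 0 <= oapp (v i) 0 (f i) by case: (f i) => /=.
(* Sum the exchange inequality over row [i]: the current weight of [i] is charged at most [#|I|]
   times, and the columns together contribute at most [W f], each matched agent being counted once.
   Summing over the rows then gives the factor [2 * #|I|]. *)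
have row i : \sum_(e in S i) v i e <= oapp (v i) 0 (f i) *+ #|I| + W f.
  apply: le_trans (ler_sum _ (exch i)) _; rewrite big_split /= lerD //.
    by rewrite sumr_const ler_wpMn2l.
  rewrite -match_sum [leLHS]big_mkcond ler_sum // => e _.
  by case: ifP => // _; rewrite sumr_ge0.
apply: le_trans (ler_sum _ (fun i _ => row i)) _.
by rewrite big_split /= sumrMnl sumr_const mul2n -addnn mulrnDr.
Qed.

(** * Allocations described by owner functions *)

Section Owners.
Context {R : realType} {n m : nat}.
Implicit Types (v : 'I_m -> R) (h : nat -> 'I_n).

(** Passing to functions on [nat] lets cut points range over all natural numbers, as in the interval
    lemmas. *)
Definition extend v (x : nat) : R := oapp v 0 (insub x).

Lemma extend_ord v (e : 'I_m) : extend v e = v e.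
Proof. by rewrite /extend valK. Qed.

Lemma extend_ge0 v : (forall e, 0 <= v e) -> forall x, 0 <= extend v x.
Proof. by move=> v0 x; rewrite /extend; case: insubP => /=. Qed.

(** Bundles read off an owner function are disjoint and cover all items by construction; only
    connectedness remains to be checked. *)
Definition owned h : {ffun 'I_n -> {set 'I_m}} :=
  [ffun j => [set x : 'I_m | h x == j]].

Lemma sum_owned h v j :
  \sum_(e in owned h j) v e = \sum_(0 <= x < m | h x == j) extend v x.
Proof.
rewrite big_mkord; apply: eq_big => [e|e _]; last by rewrite extend_ord.
by rewrite ffunE inE.
Qed.

Lemma owned_connected h :
  (forall x y z, (x <= y <= z)%N -> (z < m)%N -> h x = h z -> h y = h x) ->
  connected_partition (owned h).
Proof.
move=> hconn; apply/and3P; split.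
- apply/forallP => i; apply/forallP => a; apply/implyP; rewrite ffunE inE => /eqP ha.
  apply/forallP => c; apply/implyP; rewrite inE => /eqP hc.
  apply/forallP => b; apply/implyP => abc; rewrite inE.
  by apply/eqP; rewrite -ha; apply: hconn abc _ _; rewrite ?ha.
- apply/forallP => i; apply/forallP => j; apply/implyP => ij.
  rewrite -setI_eq0; apply/eqP/setP => x; rewrite !inE !ffunE !inE.
  by apply/negP => /andP[/eqP-> /eqP ji]; case/eqP: ij.
- apply/eqP/setP => x; rewrite finset.in_setT; apply/bigcupP; exists (h x) => //.
  by rewrite ffunE inE.
Qed.

Lemma connected_partitionP (A : {ffun 'I_n -> {set 'I_m}}) :
  connected_partition A ->
  [/\ forall i (a b c : 'I_m), a \in A i -> c \in A i -> (a <= b <= c)%N -> b \in A i,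
      forall i j e, e \in A i -> e \in A j -> i = j
    & forall e, exists i, e \in A i].
Proof.
case/and3P => conn disj /eqP cov; split.
- move=> i a b c aA cA abc.
  have /forallP/(_ a)/implyP/(_ aA)/forallP/(_ c)/implyP/(_ cA) := forallP conn i.
  by move=> /forallP/(_ b)/implyP/(_ abc).
- move=> i j e ei ej; apply/eqP; have /forallP/(_ j)/implyP := forallP disj i.
  by move=> H; apply/negPn/negP => /H/disjointFr/(_ ei); rewrite ej.
- move=> e; have : e \in [set: 'I_m]%SET by rewrite finset.in_setT.
  by rewrite -cov => /bigcupP[i _ ei]; exists i.
Qed.

End Owners.

(** * Maximin shares, fair allocations and the upper bound *)

Section MaximinShare.
Context {R : realType} {n : nat} (I : instance R n).
Hypothesis n_gt0 : (0 < n)%N.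

Lemma bundle_value_sub (i : 'I_n) (S S' : {set 'I_(items I)}) :
  S \subset S' -> bundle_value i S <= bundle_value i S'.
Proof.
move=> /fintype.subsetP sub; rewrite /bundle_value [leLHS]big_mkcond [leRHS]big_mkcond.
apply: ler_sum => e _; have := sub e; do 2 case: ifP => //.
- by move=> _ _ /(_ isT).
- by move=> _ _ _; exact: value_ge0.
Qed.

Lemma bundle_value_ge0 (i : 'I_n) (S : {set 'I_(items I)}) :
  0 <= bundle_value i S.
Proof. by apply: sumr_ge0 => e _; exact: value_ge0. Qed.

Lemma bundle_valueT (i : 'I_n) : bundle_value i [set: 'I_(items I)]%SET = 1.
Proof.
rewrite -(value_sum1 I i); apply: eq_bigl => e; exact: finset.in_setT.
Qed.

Lemma le_MMS (i : 'I_n) t (X : allocation I) : connected_partition X ->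
  (forall j, t <= bundle_value i (X j)) -> t <= MMS I i.
Proof.
move=> Xc tX; rewrite /MMS; apply: le_trans (le_bigmax_cond _ _ Xc).
(* The default of the minimum is the value of all items, which dominates [X i] and hence [t]. *)
apply: le_bigmin => [|j _]; last exact: tX.
exact: le_trans (tX i) (bundle_value_sub _ _ _ (finset.subsetT _)).
Qed.

Lemma MMS_partition (i : 'I_n) : exists2 X : allocation I,
  connected_partition X & forall j, MMS I i <= bundle_value i (X j).
Proof.
(* Giving everything to [i] shows that the maximum is over a nonempty family, so it is attained. *)
pose X0 : allocation I := owned (fun=> i).
have X0c : connected_partition X0 by exact: owned_connected.
pose low (X : allocation I) := \big[Num.min/bundle_value i [set: 'I_(items I)]%SET]_(j < n)
  bundle_value i (X j).
case: (Order.TotalTheory.arg_maxP low X0c) => X Xc Xmax; exists X => // j.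
apply: (@le_trans _ _ (low X)); last exact: bigmin_le.
apply/bigmax_leP; split=> [|Y]; last exact: Xmax.
by apply: le_bigmin => [|l _]; exact: bundle_value_ge0.
Qed.

Lemma MMS_ge0 (i : 'I_n) : 0 <= MMS I i.
Proof.
by rewrite /MMS; elim/big_rec: _ => // X x _; rewrite le_max orbC => ->.
Qed.

Let w0 (i : 'I_n) : forall x, 0 <= extend (@value _ _ I i) x.
Proof. by apply: extend_ge0; exact: value_ge0. Qed.

(** The parts of a maximin partition come in no particular order; [splits_family] turns them into
    increasing cut points. With [splits_le_MMS], this makes the share the largest [t] that admits
    [n] pieces. *)
Lemma MMS_splits (i : 'I_n) :
  splits R (extend (@value _ _ I i)) (MMS I i) (items I) n 0.
Proof.
have [X Xc XM] := MMS_partition i.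
have [conn disj _] := connected_partitionP _ Xc.
pose inX j x := oapp (fun e => e \in X j) false (insub x).
have inXP j x : inX j x -> exists2 e : 'I_(items I), val e = x & e \in X j.
  by rewrite /inX; case: insubP => //= e _ <-; exists e.
have inXE j (e : 'I_(items I)) : inX j e = (e \in X j) by rewrite /inX valK.
rewrite -[n in splits _ _ _ _ n](size_enum_ord n).
apply: (@splits_family _ _ inX); rewrite ?enum_uniq //.
- by move=> j x _ /inXP[e <- _] /=.
- move=> j x y z _ /inXP[a <- aX] /inXP[c <- cX] abc.
  have ylt : (y < items I)%N by case/andP: abc => _ yc; exact: leq_ltn_trans yc (ltn_ord c).
  by have := conn j a (Ordinal ylt) c aX cX abc; rewrite -inXE.
- by move=> j l x _ _ /inXP[e <- eX]; rewrite inXE; exact: disj eX.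
- move=> j _; apply: le_trans (XM j) _; rewrite big_mkord le_eqVlt; apply/orP; left.
  by apply/eqP/eq_big => [e|e _]; rewrite ?inXE ?extend_ord.
Qed.

(** Run the moving knife on [n] copies of agent [i] without promises: the leftover items go to the
    last copy, which yields a genuine partition. *)
Lemma splits_le_MMS (i : 'I_n) t :
  splits R (extend (@value _ _ I i)) t (items I) n 0 -> t <= MMS I i.
Proof.
move=> Dt.
have [] := @moving_knife R 'I_n (fun=> extend (@value _ _ I i)) (fun=> t) (fun=> None)
  (items I) (enum 'I_n) 0 (fun=> w0 i).
- by [].
- by rewrite -size_eq0 size_enum_ord -lt0n.
- exact: enum_uniq.
- by [].
- by rewrite size_enum_ord.
move=> h [_ hconn hval _]; apply: (le_MMS i t (owned h)).
  by apply: owned_connected => x y z; apply: hconn.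
by move=> j; rewrite /bundle_value sum_owned hval // mem_enum.
Qed.

(** The moving knife is run on all agents with their maximin shares as thresholds; [MMS_splits]
    provides for those without a promise. *)
Lemma MMS_fair_extension (f : 'I_n -> option 'I_(items I)) :
  (forall i j e, f i = Some e -> f j = Some e -> i = j) ->
  (forall i e, f i = Some e -> MMS I i <= value i e) ->
  exists2 A : allocation I,
    MMS_fair A & forall i e, f i = Some e -> e \in A i.
Proof.
move=> finj fM.
have [] := @moving_knife R 'I_n (fun i => extend (@value _ _ I i)) (MMS I)
  (fun i => omap val (f i)) (items I) (enum 'I_n) 0 w0.
- move=> i j x; case fi : (f i) => [a|//] [<-]; case fj : (f j) => [b|//] [/val_inj ba].
  by apply: (finj _ _ a); rewrite // fj ba.
- by rewrite -size_eq0 size_enum_ord -lt0n.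
- exact: enum_uniq.
- move=> i x _; case fi : (f i) => [e|//] [<-]; split; first exact: ltn_ord.
  by rewrite extend_ord; exact: fM.
- by move=> i _ _; rewrite size_enum_ord; exact: MMS_splits.
move=> h [_ hconn hval hf]; exists (owned h).
  apply/andP; split; first by apply: owned_connected => x y z; apply: hconn.
  by apply/forallP => i; rewrite /bundle_value sum_owned hval // mem_enum.
move=> i e fi; rewrite ffunE inE; apply/eqP; apply: hf; first by rewrite mem_enum.
by rewrite fi.
Qed.

Definition large_items (i : 'I_n) (t : R) : {set 'I_(items I)} :=
  [set e | t <= value i e].

(** A level strictly above the maximin share admits no split into [n] pieces, so [not_splits]
    applies. *)
Lemma large_items_value (i : 'I_n) t : MMS I i < t ->
  (#|large_items i t| < n)%N /\
  1 <= \sum_(e in large_items i t) value i e + t *+ (2 * n).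
Proof.
move=> Mt; have t0 : 0 < t := le_lt_trans (MMS_ge0 i) Mt.
have [] := not_splits R (extend (@value _ _ I i)) t (items I) n 0 (w0 i) t0 (leq0n _).
  by move=> /splits_le_MMS; rewrite leNgt Mt.
rewrite !big_mkord => cnt small; split.
  rewrite -sum1_card big_mkcond /= (leq_trans _ cnt) // ltnS leq_sum // => e _.
  by rewrite inE extend_ord; case: ifP.
rewrite -[leLHS](value_sum1 I i) (bigID (fun e => t <= value i e)) /=.
apply: lerD; first by rewrite le_eqVlt; apply/orP; left; apply/eqP/eq_bigl => e; rewrite inE.
apply: le_trans small; rewrite le_eqVlt; apply/orP; left; apply/eqP.
by apply: eq_big => [e|e _]; rewrite extend_ord // ltNge.
Qed.

Lemma UW_MMS_fair : exists2 A : allocation I, MMS_fair A & 3 / 16 <= UW A.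
Proof.
have n0 : (0 : R) < n%:R by rewrite ltr0n.
(* The perturbation makes [t i] exceed the maximin share strictly. *)
pose t i := MMS I i + (8 * n%:R)^-1.
have Mt i : MMS I i < t i by rewrite ltrDl invr_gt0 mulr_gt0.
have [f [fS finj fsum]] := @large_matching R 'I_n 'I_(items I) (@value _ _ I)
  (fun i => large_items i (t i)) (@value_ge0 _ _ I)
  (fun i => leq_trans (ltnW (large_items_value i _ (Mt i)).1) (eq_leq (esym (card_ord n)))).
have [|A Af fA] := MMS_fair_extension f finj.
  by move=> i e /fS; rewrite inE; apply: le_trans (ltW (Mt i)).
exists A => //; case/andP: Af => _ /forallP AM.
pose W := \sum_i oapp (@value _ _ I i) 0 (f i).
have MU : \sum_i MMS I i <= UW A by apply: ler_sum => i _; exact: AM.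
have WU : W <= UW A.
  apply: ler_sum => i _; case fi : (f i) => [e|] /=; last exact: bundle_value_ge0.
  rewrite /bundle_value (bigD1 e) /= ?fA // lerDl sumr_ge0 // => e' _.
  exact: value_ge0.
(* Adding the bounds of all agents gives [n <= 2n (W + M + 1/8)], where [M] is the sum of the shares
   and [1/8] the total perturbation. Hence [W + M >= 3/8], and the welfare, being at least each of
   the two, is at least [3/16]. *)
have : n%:R <= W *+ (2 * n) + \sum_i t i *+ (2 * n).
  rewrite -[X in (_ <= W *+ (_ * X) + _)%R]card_ord.
  apply: le_trans (lerD fsum (lexx _)); rewrite -big_split /=.
  rewrite -[n in n%:R]card_ord -sumr_const ler_sum // => i _.
  by have [] := large_items_value i _ (Mt i).
have E : (8 * n%:R)^-1 *+ n = 1 / 8 :> R.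
  by field; rewrite gt_eqF.
rewrite sumrMnl big_split /= sumr_const card_ord E.
rewrite -(mulr_natr W) -(mulr_natr (_ + _)) natrM.
set M := \sum_i _ in MU *.
rewrite -mulrDl [leRHS]mulrA ler_pMl ?mulr_gt0 //.
lra.
Qed.

Lemma UW_le (A : allocation I) : UW A <= n%:R.
Proof.
rewrite -[n in n%:R]card_ord -sumr_const ler_sum // => i _.
by rewrite -(bundle_valueT i) bundle_value_sub // finset.subsetT.
Qed.

Lemma price_le : (price I <= (6 * n%:R)%:E)%E.
Proof.
have [A Af UA] := UW_MMS_fair.
apply: le_trans (bigmin_le_cond _ _ Af) _.
have U0 : 0 < UW A by lra.
(* The ratio is at most [n / (3/16) = 16n/3], rounded up to [6n]. *)
rewrite /welfare_ratio gt_eqF // lee_fin ler_pdivrMr //.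
have : OPT_U I <= n%:R.
  by apply/bigmax_leP; split=> [|B _]; [exact: ler0n|exact: UW_le].
have : (0 : R) <= n%:R by exact: ler0n.
move: (n%:R : R) => x; nra.
Qed.

End MaximinShare.

(** * The block instance and the lower bound *)

Section BlockInstance.
Context {R : realType} (n k : nat) (k_gt0 : (0 < k)%N) (kn : (k * k <= n)%N).

Let block (i e : nat) := (i * k <= e < i.+1 * k)%N.

(** For an agent below [k], the block term and the uniform term each total one half; the uniform
    term keeps every item positive. The bound [k * k <= n] makes the [k] blocks fit. *)
Definition block_value (i : 'I_n) (e : 'I_n) : R :=
  if (i < k)%N then (if block i e then (2 * k%:R)^-1 else 0) + (2 * n%:R)^-1
  else n%:R^-1.

Let k0 : (0 : R) < k%:R. Proof. by rewrite ltr0n. Qed.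
Let n_gt0 : (0 < n)%N. Proof. by apply: leq_trans kn; rewrite muln_gt0 k_gt0. Qed.
Let n0 : (0 : R) < n%:R. Proof. by rewrite ltr0n. Qed.

Lemma block_value_ge (i e : 'I_n) : (2 * n%:R)^-1 <= block_value i e.
Proof.
rewrite /block_value; case: ifP => _.
  by rewrite lerDr; case: ifP => // _; rewrite invr_ge0 mulr_ge0 // ltW.
by rewrite lef_pV2 ?posrE ?mulr_gt0 // ler_peMl ?ler1n // ltW.
Qed.

Let share_gt0 : 0 < (2 * n%:R)^-1 :> R.
Proof. by rewrite invr_gt0 mulr_gt0. Qed.

Lemma block_value_ge0 (i e : 'I_n) : 0 <= block_value i e.
Proof. exact: le_trans (ltW share_gt0) (block_value_ge i e). Qed.

Lemma sum_block (i : nat) : (i < k)%N ->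
  \sum_(e < n | block i e) (2 * k%:R)^-1 = 1 / 2 :> R.
Proof.
move=> ik; rewrite -(big_mkord (block i) (fun=> (2 * k%:R)^-1)).
have lek : (i.+1 * k <= n)%N by apply: leq_trans kn; rewrite leq_mul2r ik orbT.
rewrite (big_cat_nat (leq0n (i * k)) (leq_trans _ lek)) ?leq_mul2r ?leqnSn ?orbT //=.
rewrite (big_cat_nat _ lek) ?leq_mul2r ?leqnSn ?orbT //=.
rewrite big_nat_cond big_pred0 ?add0r; last by move=> e; rewrite /block; lia.
rewrite [X in _ + X]big_nat_cond [X in _ + X]big_pred0 ?addr0; last first.
  by move=> e; rewrite /block; lia.
rewrite big_nat_cond (eq_bigl (fun e => block i e && true)); last first.
  by move=> e; rewrite /block; case: (i * k <= e < i.+1 * k)%N.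
rewrite -(big_nat_cond _ _ _ _ xpredT) sumr_const_nat mulSn addnK.
by field; rewrite gt_eqF.
Qed.

Lemma block_value_sum1 (i : 'I_n) : \sum_(e < n) block_value i e = 1.
Proof.
rewrite /block_value; case: (ltnP i k) => ik.
  rewrite big_split /= -big_mkcond sum_block // sumr_const card_ord.
  by field; rewrite gt_eqF.
by rewrite sumr_const card_ord -(mulr_natr n%:R^-1) mulVf // gt_eqF.
Qed.

Definition block_instance : instance R n :=
  Instance block_value_ge0 block_value_sum1.

Lemma block_OPT : k%:R / 2 <= OPT_U block_instance.
Proof.
have n1 := prednK n_gt0.
(* Block [i] goes to agent [i], and the cap at [k.-1] hands the items after the last block to the
   last of these agents. Monotonicity of the quotient makes the bundles connected. *)
pose own (x : nat) : 'I_n := cast_ord n1 (inord (minn (x %/ k) k.-1)).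
have own_val x : own x = minn (x %/ k) k.-1 :> nat.
  rewrite /= inordK //; move: k_gt0 kn; case: (k) => // k' _ /=.
  by rewrite n1 => kkn; apply: leq_trans kkn; rewrite mulSn; lia.
have oc : connected_partition (owned own : allocation block_instance).
  apply: owned_connected => x y z /andP[xy yz] _ /(congr1 (@nat_of_ord n)).
  rewrite !own_val => oxz; apply: ord_inj; rewrite !own_val; move: oxz.
  have := leq_div2r k xy; have := leq_div2r k yz; lia.
apply: le_trans (le_bigmax_cond _ _ oc); rewrite /UW.
have kln : (k <= n)%N by apply: leq_trans kn; rewrite leq_pmulr.
have -> : k%:R / 2 = \sum_(i < n | (i < k)%N) (1 / 2) :> R.
  by rewrite -(big_ord_widen n (fun=> 1 / 2)) // sumr_const card_ord; field.
rewrite big_mkcond ler_sum // => i _; case: ifP => ik; last exact: bundle_value_ge0.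
rewrite -(sum_block i ik) /bundle_value [leLHS]big_mkcond [leRHS]big_mkcond.
apply: ler_sum => e _; case: ifP => [be|_]; last first.
  by case: ifP => // _; exact: block_value_ge0.
have -> : e \in (owned own : allocation block_instance) i.
  rewrite ffunE inE; apply/eqP/ord_inj; rewrite own_val.
  have -> : (e %/ k)%N = i.
    by move: be => /andP[le lt]; apply/eqP; rewrite eqn_leq -ltnS ltn_divLR // lt leq_divRL.
  by move: k_gt0 ik; lia.
by rewrite /= /block_value ik be lerDl ltW.
Qed.

(** One item per agent is a partition into parts of positive value, so all shares are positive and
    no fair bundle is empty. With as many items as agents, each bundle is a single item. The block
    terms then total at most [k / (2k)] and the remaining terms at most [1], so [3/2] altogether. *)
Lemma block_UW (A : allocation block_instance) : MMS_fair A -> UW A <= 2.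
Proof.
case/andP => /connected_partitionP[_ disj _] /forallP AM.
have Mpos i : 0 < MMS block_instance i.
  apply: lt_le_trans share_gt0 _.
  have n1 := prednK n_gt0.
  pose own (x : nat) : 'I_n := cast_ord n1 (inord x).
  have own_val x : (x < n)%N -> own x = x :> nat.
    by move=> xn; rewrite /= inordK // n1.
  apply: (le_MMS _ i _ (owned own)).
    apply: owned_connected => x y z /andP[xy yz] zn /(congr1 (@nat_of_ord n)).
    have yn := leq_ltn_trans yz zn; have xn := leq_ltn_trans xy yn.
    by rewrite !own_val // => xz; have -> : y = x by lia.
  move=> j; rewrite /bundle_value (bigD1 j) /=; last first.
    by rewrite ffunE inE; apply/eqP/ord_inj; rewrite own_val.
  apply: le_trans (block_value_ge i j) _; rewrite lerDl sumr_ge0 // => e _.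
  exact: block_value_ge0.
have ne i : exists e, e \in A i.
  apply/set0Pn; apply: contraTneq (lt_le_trans (Mpos i) (AM i)) => ->.
  by rewrite /bundle_value big_set0 ltxx.
pose e_ i := xchoose (ne i).
have e_A i : e_ i \in A i := xchooseP (ne i).
have e_inj : injective e_.
  by move=> i j eij; apply: (disj _ _ (e_ i)) => //; rewrite eij.
(* An injective map from ['I_n] to itself is onto, so every item is the chosen item of some agent,
   and disjointness identifies that agent. *)
have Ai i : A i \subset [set e_ i].
  apply/fintype.subsetP => e eA; rewrite inE.
  have /codomP[j ej] : e \in codom e_ by exact: injF_onto.
  by rewrite ej in eA *; apply/eqP; congr e_; exact: (disj _ _ (e_ j)).
have bound i : bundle_value i (A i) <=
    (if (i < k)%N then (2 * k%:R)^-1 else 0) + n%:R^-1.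
  apply: le_trans (bundle_value_sub _ _ _ _ (Ai i)) _.
  rewrite /bundle_value big_set1 /= /block_value; case: ifP => _; last by rewrite add0r.
  apply: lerD; first by case: ifP => // _; rewrite invr_ge0 mulr_ge0 // ltW.
  by rewrite lef_pV2 ?posrE ?mulr_gt0 // ler_peMl ?ler1n // ltW.
apply: le_trans (ler_sum _ (fun i _ => bound i)) _.
have kln : (k <= n)%N by apply: leq_trans kn; rewrite leq_pmulr.
rewrite big_split /= -big_mkcond -(big_ord_widen n (fun=> (2 * k%:R)^-1)) //.
have -> : \sum_(i < k) (2 * k%:R)^-1 = 1 / 2 :> R.
  by rewrite sumr_const card_ord; field; rewrite gt_eqF.
rewrite sumr_const card_ord -(mulr_natr n%:R^-1) mulVf ?gt_eqF //.
lra.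
Qed.

Lemma block_price : ((k%:R / 4)%:E <= price block_instance)%E.
Proof.
apply: le_bigmin => [|A Af]; first exact: leey.
have O := block_OPT; have U := block_UW A Af.
(* For zero welfare the ratio is infinite because the optimum is positive; otherwise it is at least
   [(k/2) / 2]. *)
rewrite /welfare_ratio; case: eqVneq => [_|U0].
  by rewrite gt_eqF ?leey //; apply: lt_le_trans O; rewrite divr_gt0.
have {}U0 : 0 < UW A.
  by rewrite lt_def U0 sumr_ge0 // => i _; exact: bundle_value_ge0.
rewrite lee_fin ler_pdivlMr //; have := ler_wpM2l (ltW k0) U; lra.
Qed.

End BlockInstance.

(** * Choice of the block length and the two bounds together *)

Lemma sqrtn_exists (n : nat) : exists k, (k * k <= n < k.+1 * k.+1)%N.
Proof.
elim: n => [|n [k /andP[lo hi]]]; first by exists 0%N.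
by have [lt|ge] := leqP (k.+1 * k.+1) n.+1; [exists k.+1; lia|exists k; lia].
Qed.

Theorem theorem5 (R : realType) :
  exists c C : R, 0 < c /\ 0 < C /\
    forall n : nat, (3 <= n)%N ->
      ((c * Num.sqrt n%:R)%:E <= PoF R n)%E /\ (PoF R n <= (C * n%:R)%:E)%E.
Proof.
(* With [k] the integer part of the square root of [n], that root is at most [k + 1 <= 2k], so the
   price [k / 4] of the block instance yields the constant [1/8]; the constant [6] is that of
   [price_le]. *)
exists (1 / 8), 6; split; first lra; split=> [//|n n3].
have n_gt0 : (0 < n)%N by apply: leq_trans n3.
split; last first.
  by apply/ereal_supP => _ [I _ <-]; exact: price_le.
have [k /andP[lo hi]] := sqrtn_exists n.
have k_gt0 : (0 < k)%N by case: k hi {lo} => //; lia.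
apply: le_ereal_sup_tmp; exists (price (block_instance n k k_gt0 lo)).
  by exists (block_instance n k k_gt0 lo).
apply: le_trans (block_price n k k_gt0 lo); rewrite lee_fin.
have : Num.sqrt n%:R <= 2 * k%:R :> R.
  rewrite -[leRHS]ger0_norm ?mulr_ge0 // -sqrtr_sqr ler_wsqrtr //.
  by rewrite -natrM -natrX ler_nat -mulnn; nia.
lra.
Qed.
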